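(* Let $(X_n(t))_{t\in\mathbb R^q}$, $n\in\mathbb N$, be a sequence of real-valued stochastic processes. For any hyperrectangle $B=(s_1,t_1]\times\cdots\times(s_q,t_q]$, the increment of $X_n$ around $B$ is given by $$X_n(B)=\sum_{(\varepsilon_1,\dots,\varepsilon_q)\in\{0,1\}^q}(-1)^{q-(\varepsilon_1+\cdots+\varepsilon_q)}X_n(s_1+\varepsilon_1(t_1-s_1),\dots,s_q+\varepsilon_q(t_q-s_q)).$$ Suppose that there exists a sequence of measures $(\mu_n)_{n\in\mathbb N}$ on $(\mathbb R^q,\mathcal B^q)$ with continuous marginals which converges weakly to a finite measure $\mu$, also having continuous marginals, and $$E[X_n(B)]^4\le[\mu_n(B)+Cn^{-q}]^{1+\gamma}$$ for all hyperrectangles $B$ and some $\gamma>0$, $C<\infty$. Let $\delta$ and $\eta$ be arbitrary positive constants. There then exists a coarse grid $\mathcal G=\{b_0^{(1)},\dots,b_M^{(1)}\}\times\cdots\times\{b_0^{(q)},\dots,b_M^{(q)}\}$ with $-\infty=b_0^{(r)}<\cdots<b_M^{(r)}=\infty$ ($r=1,\dots,q$) and a sequence of fine grids $\mathcal G_n=\{t_{n,1}^{(1)},\dots,t_{n,M_n}^{(1)}\}\times\cdots\times\{t_{n,1}^{(q)},\dots,t_{n,M_n}^{(q)}\}$ with $\mathcal G\subseteq\mathcal G_n$ such that $$\mu_n\big(\mathbb R^{r-1}\times(t_{n,k-1}^{(r)},t_{n,k}^{(r)}]\times\mathbb R^{q-r}\big)\le2\mu(\mathbb R^q)n^{-1}\qquad\forall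 k=2,\dots,M_n,\ \forall r=1,\dots,q$$ and $$P\Big(\max_{1\le i_1,\dots,i_q\le M}\ \max_{t\in\mathcal G_n:\,b(\underline i-\mathbb 1_q)\preceq t\preceq b(\underline i)}|X_n(t)-X_n(b(\underline i))|>\delta\Big)\le\eta$$ holds for all $n\ge n_0$, where $n_0$ is sufficiently large.
   Context: $\mathcal B^q$ is the Borel $\sigma$-field on $\mathbb R^q$; $\underline i=(i_1,\dots,i_q)$, $\mathbb 1_q=(1,\dots,1)$, $b(\underline i)=(b_{i_1}^{(1)},\dots,b_{i_q}^{(q)})$; $x\preceq y$ means $x_i\le y_i$ for all $i$. Grid points in each coordinate are listed in increasing order and may be $\pm\infty$. Where points with infinite coordinates occur (as grid points or as corners of hyperrectangles), $X_n$ is understood as a process on the extended space $\bar{\mathbb R}^q=[-\infty,\infty]^q$, and $\mu_n$ of a set means $\mu_n$ of its intersection with $\mathbb R^q$. ''Continuous marginals'' means that the one-dimensional marginal distribution functions are continuous.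
   Formalization: Adds that X_n takes one common value at all points with a coordinate −∞ (else false for q≥2: X_n(t)=nΦ(t_1) has zero increments), that μ(R^q)≠0 (else false: μ=0, μ_n=N(0,I)/n, X_n=0), and that C≥0 so that the power is defined. *)

(* Defs.v *)
From mathcomp Require Import all_boot all_order all_algebra.
From mathcomp Require Import all_classical all_reals all_analysis.

Set Implicit Arguments.
Unset Strict Implicit.
Unset Printing Implicit Defensive.

Import Order.TTheory GRing.Theory Num.Theory.
Import numFieldNormedType.Exports.

Local Open Scope classical_set_scope.
Local Open Scope ring_scope.

(* R^q with its Borel sigma-field, generated by the open sets of the usual
   (product) topology. *)
Definition borelRq (R : realType) (q : nat) :=
  g_sigma_algebraType (@open 'rV[R]_q).

Section defs.
Context {R : realType} {q : nat}.

(* A point of the extended space [-oo, +oo]^q is a function 'I_q -> \bar R. *)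

(* The trace on R^q of the hyperrectangle (s_1,t_1] x ... x (s_q,t_q]. *)
Definition hrect (s t : 'I_q -> \bar R) : set (borelRq R q) :=
  [set x : 'rV[R]_q | forall r, (s r < (x ord0 r)%:E <= t r)%E].

(* The trace on R^q of R^{r-1} x (a,b] x R^{q-r}. *)
Definition strip (r : 'I_q) (a b : \bar R) : set (borelRq R q) :=
  [set x : 'rV[R]_q | (a < (x ord0 r)%:E <= b)%E].

(* s_r + e_r (t_r - s_r) is written as a choice between s_r and t_r, so that it
   also makes sense at infinite coordinates. *)
Definition increment (T : Type) (Y : ('I_q -> \bar R) -> T -> R)
    (s t : 'I_q -> \bar R) (w : T) : R :=
  \sum_(e : {ffun 'I_q -> bool})
    (-1) ^+ (q - \sum_r e r) * Y (fun r => if e r then t r else s r) w.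

(* The distribution function is \bar R-valued because the measure is not
   required to be finite. *)
Definition continuous_marginals
    (m : {measure set (borelRq R q) -> \bar R}) : Prop :=
  forall r : 'I_q,
    continuous (fun a : R => m [set x : 'rV[R]_q | x ord0 r <= a]).

Definition converges_weakly
    (m_ : nat -> {measure set (borelRq R q) -> \bar R})
    (m : {measure set (borelRq R q) -> \bar R}) : Prop :=
  forall f : 'rV[R]_q -> R, continuous f ->
    (exists K : R, forall x, `|f x| <= K) ->
    (\int[m_ n]_(x in setT) (f x)%:E)%E @[n --> \oo] -->
    (\int[m]_(x in setT) (f x)%:E)%E.

(* g r 0 < ... < g r (N - 1) are the N points of the r-th coordinate; the values
   g r k with N <= k are irrelevant. *)
Definition increasing_axes (N : nat) (g : 'I_q -> nat -> \bar R) : Prop :=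
  forall r j k, (j < k < N)%N -> (g r j < g r k)%E.

Definition gridpt (g : 'I_q -> nat -> \bar R) (k : 'I_q -> nat) :
  'I_q -> \bar R := fun r => g r (k r).

Definition grid (N : nat) (g : 'I_q -> nat -> \bar R) : set ('I_q -> \bar R) :=
  [set x | exists2 k : 'I_q -> nat, (forall r, (k r < N)%N) & x = gridpt g k].

(* max_{1 <= i_1,...,i_q <= M} max { |Y(t) - Y(b(i))| : t in the fine grid,
   b(i - 1) <= t <= b(i) }, where (b, M) is the coarse grid and (g, N) the fine
   one. The upper corner b(i) has indices (i r).+1, i r : 'I_M. The default 0
   of the maxima is harmless since all terms are nonnegative. *)
Definition max_osc (T : Type) (Y : ('I_q -> \bar R) -> T -> R)
    (M : nat) (b : 'I_q -> nat -> \bar R)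
    (N : nat) (g : 'I_q -> nat -> \bar R) (w : T) : R :=
  \big[Num.max/0]_(i : {ffun 'I_q -> 'I_M})
  \big[Num.max/0]_(k : {ffun 'I_q -> 'I_N} |
      [forall r, (b r (i r) <= g r (k r) <= b r (i r).+1)%E])
    `|Y (gridpt g (fun r => k r)) w - Y (gridpt b (fun r => (i r).+1)) w|.

(* How a process on R^q is extended to [-oo, +oo]^q: its value is the same at
   all points having a coordinate -oo, as for the usual convention Y(t) = 0 at
   such points. For q = 1 this is no condition. For q >= 2 increments around
   hyperrectangles determine differences Y(t) - Y(t') only if the lower boundary
   is fixed in this way: Y(t) = h(t_1) has all its increments equal to 0. *)
Definition constant_on_lower_boundary (T : Type)
    (Y : ('I_q -> \bar R) -> T -> R) : Prop :=
  forall t : 'I_q -> \bar R, (exists r, t r = -oo%E) ->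
    Y t = Y (fun=> -oo%E).

End defs.

(* Main.v *)
Require Import Defs.
From mathcomp Require Import all_boot all_order all_algebra.
From mathcomp Require Import all_classical all_reals all_analysis.
From mathcomp Require Import measurable_realfun lra ring zify.

(** Fix a large M and cut the space, in each coordinate, into M strips of equal
    mu-mass. By weak convergence and the continuity of the limit marginals, the
    mu_n-mass of each of these q * M slabs (all points with one coordinate in a
    given interval) is at most 2 mu(R^q) / M for large n.
    Each coarse strip is then cut into K pieces of equal mu_n-mass, where M * K
    lies between n and 2 n; this gives the fine grid.

    On the fine grid the error term C n^-q can be made additive: a nondegenerate
    block contains at least one cell, so E[X_n(B)]^4 <= m(B)^(1 + gamma), where
    m(B) is mu_n(B) plus C n^-q times the number of cells of B ([block_moment]).
    The set function m is additive and, since a slab has at most 2^q n^q / M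
    cells, m(slab) <= A / M with A = 2 mu(R^q) + 2^q C.

    An additive bound with an exponent larger than 1 on the fourth moments of
    the increments carries over, up to a constant, to their maximum over all
    blocks of a slab with a fixed lower corner ([maximal_inequality]). In one
    dimension this is proved by bisection ([maximal_inequality_1d]); increments
    being additive in each coordinate, the coordinates are treated one after
    another.

    Since the process is constant on the lower boundary, the difference of its
    values at two points is a difference of increments with lower corner -oo. It
    decomposes into q pieces, each contained in a slab orthogonal to one
    coordinate ([block_telescope], [max_osc_le]). Markov's inequality over the
    q * M slabs bounds the probability in question by a constant times
    q * M * (A / M)^(1 + gamma), which is as small as desired when M is large
    ([prob_max_osc_le], [coarse_grid_size]). *)

Set Implicit Arguments.
Unset Strict Implicit.
Unset Printing Implicit Defensive.

Import Order.TTheory GRing.Theory Num.Theory.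
Import numFieldNormedType.Exports.

Local Open Scope classical_set_scope.
Local Open Scope ring_scope.

(** * Fourth moments and maxima along one coordinate *)

(** The point is that the coefficient of the second term can be taken as close
    to 1 as desired, at the expense of the first one: this lets the halving
    recursion of the maximal inequality close up. *)
Lemma exprD4_le (R : realType) (B : R) : 1 < B ->
  exists2 A : R, 1 <= A &
    forall x y, 0 <= x -> 0 <= y -> (x + y) ^+ 4 <= A * x ^+ 4 + B * y ^+ 4.
Proof.
move=> B1; pose e := Num.min 1 ((B - 1) / 15).
have e0 : 0 < e by rewrite lt_min ltr01 divr_gt0//; lra.
have e1 : e <= 1 by rewrite ge_min lexx.
have eB : 15 * e <= B - 1.
  by rewrite mulrC -ler_pdivlMr// ge_min lexx orbT.
(* As e <= 1, (1 + e) ^ 4 <= 1 + 15 e. *)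
have eB4 : (1 + e) ^+ 4 <= B.
  have e2 : e ^+ 2 <= e by rewrite expr2 ger_pMl.
  have e3 : e ^+ 3 <= e by rewrite exprS (le_trans _ e2)// expr2 ler_pM2l.
  have e4 : e ^+ 4 <= e by rewrite exprS (le_trans _ e2)// expr2 ler_pM2l.
  have -> : (1 + e) ^+ 4 = 1 + 4 * e + 6 * e ^+ 2 + 4 * e ^+ 3 + e ^+ 4 by ring.
  lra.
have ei0 : 0 <= e^-1 by rewrite invr_ge0 ltW.
exists ((1 + e^-1) ^+ 4) => [|x y x0 y0].
  by rewrite exprn_ege1// lerDl.
(* A small x is absorbed by y, a large one dominates y. *)
have [xy|/ltW xy] := leP x (e * y).
  apply: (@le_trans _ _ ((1 + e) ^+ 4 * y ^+ 4)).
    by rewrite -exprMn lerXn2r// ?nnegrE ?addr_ge0 ?mulr_ge0//; nra.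
  by rewrite -[leLHS]add0r lerD ?ler_wpM2r ?mulr_ge0 ?exprn_ge0 ?addr_ge0//.
have {}xy : y <= e^-1 * x by rewrite ler_pdivlMl.
apply: (@le_trans _ _ ((1 + e^-1) ^+ 4 * x ^+ 4)).
  by rewrite -exprMn lerXn2r// ?nnegrE ?addr_ge0 ?mulr_ge0 ?addr_ge0//; nra.
by rewrite lerDl mulr_ge0 ?exprn_ge0//; lra.
Qed.

Lemma bigmax_nat_ub (R : realType) (F : nat -> R) i k j :
  (i <= j <= k)%N -> F j <= \big[Num.max/0]_(i <= l < k.+1) F l.
Proof.
by move=> ijk; apply: le_bigmax_seq => //; rewrite mem_index_iota ltnS.
Qed.

Lemma bigmax_nat_le (R : realType) (F : nat -> R) i k c : 0 <= c ->
  (forall j, (i <= j <= k)%N -> F j <= c) ->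
  \big[Num.max/0]_(i <= l < k.+1) F l <= c.
Proof.
move=> c0 Fc; rewrite big_seq; apply: bigmax_le => // j.
by rewrite mem_index_iota ltnS => /Fc.
Qed.

Lemma bigmax_ge0 (R : realType) (I : Type) (s : seq I) (P : pred I) (F : I -> R) :
  0 <= \big[Num.max/0]_(l <- s | P l) F l.
Proof. by elim/big_rec : _ => // i x _ x0; rewrite le_max x0 orbT. Qed.

Lemma measurable_bigmax (R : realType) d (T : measurableType d) (I : Type)
    (s : seq I) (P : pred I) (F : I -> T -> R) :
  (forall i, measurable_fun setT (F i)) ->
  measurable_fun setT (fun w => \big[Num.max/0]_(i <- s | P i) F i w).
Proof.
move=> mF; elim: s => [|i s IH].
  by under eq_fun do rewrite big_nil; exact: measurable_cst.
under eq_fun do rewrite big_cons.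
by case: (P i) => //; exact: measurable_maxr.
Qed.

Lemma le_powR (R : realType) (r x y : R) :
  0 <= r -> 0 <= x -> x <= y -> x `^ r <= y `^ r.
Proof.
by move=> r0 x0 xy; apply: ge0_ler_powR => //; rewrite nnegrE// (le_trans x0).
Qed.

Definition moment4 (R : realType) d (T : measurableType d) (P : probability T R)
  (Y : T -> R) : \bar R := (\int[P]_w (Y w ^+ 4)%:E)%E.

Section moment4.
Context (R : realType) d (T : measurableType d) (P : probability T R).
Implicit Types Y Z : T -> R.

Lemma measurable_pow4 Y : measurable_fun setT Y ->
  measurable_fun setT (fun w => (Y w ^+ 4)%:E).
Proof. by move=> mY; apply/measurable_EFinP; exact: measurable_funX. Qed.

Lemma pow4_ge0 (x : R) : 0 <= x ^+ 4.
Proof. by rewrite (_ : 4 = 2 * 2)%N// exprM sqr_ge0. Qed.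

Lemma moment4_le_comb Y Z1 Z2 Z3 (A B : R) : 0 <= A -> 0 <= B ->
  measurable_fun setT Y -> measurable_fun setT Z1 ->
  measurable_fun setT Z2 -> measurable_fun setT Z3 ->
  (forall w, Y w ^+ 4 <= A * Z1 w ^+ 4 + B * (Z2 w ^+ 4 + Z3 w ^+ 4)) ->
  (moment4 P Y <= A%:E * moment4 P Z1 + B%:E * (moment4 P Z2 + moment4 P Z3))%E.
Proof.
move=> A0 B0 mY m1 m2 m3 YZ; rewrite /moment4.
have p4 (X : T -> R) : measurable_fun setT X ->
    measurable_fun setT (fun w : T => X w ^+ 4).
  by move=> ?; exact: measurable_funX.
rewrite -ge0_integralD//; try exact: measurable_pow4.
2,3: by move=> w _; rewrite lee_fin pow4_ge0.
rewrite -!ge0_integralZl_EFin//; try exact: measurable_pow4.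
2: by move=> w _; rewrite -EFinD lee_fin addr_ge0 ?pow4_ge0.
2: by apply/measurable_EFinP; apply: measurable_funD; exact: p4.
2: by move=> w _; rewrite lee_fin pow4_ge0.
rewrite -ge0_integralD//.
2: by move=> w _; rewrite -EFinM lee_fin mulr_ge0 ?pow4_ge0.
2: by apply/measurable_EFinP; apply: measurable_funM => //; exact: p4.
2: by move=> w _; rewrite -EFinD -EFinM lee_fin mulr_ge0// addr_ge0 ?pow4_ge0.
2: apply/measurable_EFinP; apply: measurable_funM => //.
2: by apply: measurable_funD; exact: p4.
apply: ge0_le_integral => //.
- by move=> w _; rewrite lee_fin pow4_ge0.
- exact: measurable_pow4.
- apply/measurable_EFinP; apply: measurable_funD => //; apply: measurable_funM => //.
    exact: p4.
  by apply: measurable_funD; exact: p4.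
- by move=> w _; rewrite -EFinD lee_fin.
Qed.
End moment4.

Section maximal_inequality_1d.
Context (R : realType) d (T : measurableType d) (P : probability T R).

(** The bisection argument of Moricz. Let [g] be an additive interval function
    that dominates the fourth moments of the subadditive family [Y]. Choose the
    first [m] for which (i,m] carries at least half of the mass g(i,k). Then
    each maximum over (i,m-1] and (m,k] is controlled, by induction, with half
    of the mass, and
      max_j Y(i,j) <= Y(i,m) + max (max over (i,m-1]) (max over (m,k]).
    Each of the last two maxima contributes with the factor 2^-alpha, so both
    together with 2^(1 - alpha) < 1, and the constant does not grow along the
    recursion. The factor [L] makes the lemma usable several times in a row,
    once for each coordinate. *)
Lemma maximal_inequality_1d (alpha : R) : 1 < alpha -> exists2 K : R, 1 <= K &
  forall (Y : nat -> nat -> T -> R) (g : nat -> nat -> R) (L : R), 0 <= L ->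
  (forall i j, measurable_fun setT (Y i j)) ->
  (forall i j w, 0 <= Y i j w) ->
  (forall i j k w, (i <= j <= k)%N -> Y i k w <= Y i j w + Y j k w) ->
  (forall i j, (i <= j)%N -> 0 <= g i j) ->
  (forall i j k, (i <= j <= k)%N -> g i k = g i j + g j k) ->
  (forall i j, (i <= j)%N -> (moment4 P (Y i j) <= (L * g i j `^ alpha)%:E)%E) ->
  forall i k, (i <= k)%N ->
    (moment4 P (fun w => (\big[Num.max/0]_(i <= j < k.+1) Y i j w)%R)
      <= (K * L * g i k `^ alpha)%:E)%E.
Proof.
move=> a1; pose c : R := 2 `^ (alpha - 1).
have c1 : 1 < c.
  have := @gt0_ltr_powR R (alpha - 1) _ 1 2 _ _ _.
  by rewrite powR1 !nnegrE ltr1n; apply=> //; rewrite subr_gt0.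
have [|A A1 hA] := @exprD4_le R ((1 + c) / 2); first by lra.
(* K solves K = A + B * K / c, the balance of one step of the recursion. *)
pose B := (1 + c) / 2; pose K := A * c / (c - B).
have B1 : 1 < B by rewrite /B; lra.
have Bc : B < c by rewrite /B; lra.
have cB : 0 < c - B by lra.
have K1 : 1 <= K.
  rewrite /K ler_pdivlMr// mul1r; nra.
exists K => // Y g L L0 mY Y0 Ysub g0 gadd hY i k ik.
have [n] := ubnP (k - i); elim: n i k ik => // n IH i k ik.
rewrite ltnS => kin.
have K0 : 0 <= K by lra.
have gi0 : forall i, g i i = 0.
  move=> j; have := gadd j j j; rewrite leqnn => /(_ isT); lra.
have [->|ltik] := eqVneq i k.
  rewrite (_ : (fun w => _) = Y k k); last first.
    by apply/funext => w; rewrite big_ltn// big_geq// max_l.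
  rewrite (le_trans (hY k k _))// lee_fin ler_wpM2r ?powR_ge0//.
  by rewrite -[leLHS]mul1r ler_wpM2r.
have {}ltik : (i < k)%N by rewrite ltn_neqAle ltik.
have gik0 := g0 _ _ ik.
have exm : exists m, (i < m)%N && (g i k <= 2 * g i m).
  by exists k; rewrite ltik/=; lra.
case: (ex_minnP exm) => m /andP[im gm] minm.
have mk : (m <= k)%N by apply: minm; rewrite ltik/=; lra.
have gm1 : g i m.-1 <= g i k / 2.
  have [e|ne] := eqVneq m.-1 i; first by rewrite e gi0 divr_ge0.
  rewrite leNgt; apply/negP => gm1.
  have /minm : (i < m.-1)%N && (g i k <= 2 * g i m.-1).
    apply/andP; split; last by lra.
    by clear -im ne; lia.
  by clear -im; lia.
have gmk : g m k <= g i k / 2 by have := gadd i m k; rewrite (ltnW im) mk => /(_ isT); lra.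
have gim : g i m <= g i k.
  have := gadd i m k; rewrite (ltnW im) mk => /(_ isT).
  by have := g0 m k mk; lra.
pose M i k w := \big[Num.max/0]_(i <= j < k.+1) Y i j w.
have mM a b : measurable_fun setT (M a b) by exact: measurable_bigmax.
have M0 a b w : 0 <= M a b w by exact: bigmax_ge0.
have M2 : (moment4 P (M i m.-1) <= (K * L * (g i k / 2) `^ alpha)%:E)%E.
  apply: le_trans (IH _ _ _ _) _; [by clear -im; lia|by clear -im mk kin; lia|].
  rewrite lee_fin; apply: ler_wpM2l; first exact: mulr_ge0.
  apply: le_powR => //; first by lra.
  by apply: g0; clear -im; lia.
have M3 : (moment4 P (M m k) <= (K * L * (g i k / 2) `^ alpha)%:E)%E.
  apply: le_trans (IH _ _ _ _) _; [by []|by clear -im mk kin; lia|].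
  rewrite lee_fin; apply: ler_wpM2l; first exact: mulr_ge0.
  apply: le_powR => //; first by lra.
  exact: g0.
have M1 : (moment4 P (Y i m) <= (L * g i k `^ alpha)%:E)%E.
  apply: le_trans (hY _ _ (ltnW im)) _.
  rewrite lee_fin; apply: ler_wpM2l => //.
  by apply: le_powR => //; [lra|exact/g0/ltnW].
apply: (@le_trans _ _ (A%:E * moment4 P (Y i m) + B%:E * (moment4 P (M i m.-1) + moment4 P (M m k)))%E).
  apply: moment4_le_comb => //; [by lra|by lra|exact: mM|].
  move=> w; apply: (@le_trans _ _ ((Y i m w + Num.max (M i m.-1 w) (M m k w)) ^+ 4)).
    rewrite lerXn2r ?nnegrE ?addr_ge0 ?bigmax_ge0 ?le_max ?M0//.
    apply: bigmax_nat_le; first by rewrite addr_ge0// le_max M0.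
    move=> j /andP[ij jk]; have [jm|mj] := ltnP j m.
      rewrite -[leLHS]add0r lerD// le_max; apply/orP; left.
      by apply: (bigmax_nat_ub (Y i ^~ w)); clear -ij jk jm; lia.
    apply: le_trans (Ysub i m j w _) _; first by rewrite ltnW.
    rewrite lerD2l le_max; apply/orP; right.
    by apply: (bigmax_nat_ub (Y m ^~ w)); clear -ij jk mj; lia.
  apply: le_trans (hA _ _ _ _) _ => //; first by rewrite le_max M0.
  rewrite lerD2l ler_wpM2l//; first by lra.
  by rewrite /Num.max; case: ifP => _; rewrite ?lerDl ?lerDr pow4_ge0.
have -> : K * L * g i k `^ alpha = A * (L * g i k `^ alpha) +
   B * (K * L * (g i k / 2) `^ alpha + K * L * (g i k / 2) `^ alpha).
  have c2 : 2 `^ alpha = 2 * c by rewrite -mulr_powRB1//; lra.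
  have -> : (g i k / 2) `^ alpha = g i k `^ alpha / (2 * c).
    have gE : g i k = (g i k / 2) * 2 by lra.
    rewrite [in RHS]gE [in RHS]powRM ?divr_ge0// c2 mulfK//; lra.
  rewrite /K; field; apply/andP; split; lra.
rewrite EFinD (EFinM A) (EFinM B) EFinD.
apply: leeD; apply: lee_wpmul2l; rewrite ?lee_fin//; [by lra|by lra|].
exact: leeD.
Qed.
End maximal_inequality_1d.

(** * Maxima over blocks of a grid *)

Section upd.
Context {q : nat} {A : Type}.
Implicit Types s t : 'I_q -> A.

Definition upd s (r : 'I_q) (x : A) : 'I_q -> A :=
  fun i => if i == r then x else s i.

Lemma upd_same s r x : upd s r x r = x.
Proof. by rewrite /upd eqxx. Qed.

Lemma upd_id s r : upd s r (s r) = s.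
Proof. by apply/funext => i; rewrite /upd; case: eqP => [->|]. Qed.

Lemma updK s r x y : upd (upd s r x) r y = upd s r y.
Proof. by apply/funext => i; rewrite /upd; case: eqP. Qed.

Lemma updC s r r' x y : r' != r ->
  upd (upd s r x) r' y = upd (upd s r' y) r x.
Proof.
move=> rr'; apply/funext => i; rewrite /upd.
by case: (eqVneq i r') => // ->; rewrite (negPf rr').
Qed.
End upd.

Section blocks.
Context (R : realType) (q : nat).
Implicit Types (s t u : 'I_q -> nat).

Definition block_le s t := forall r, (s r <= t r)%N.

Lemma block_le_upd s t r i j : (forall r', r' != r -> (s r' <= t r')%N) ->
  (i <= j)%N -> block_le (upd s r i) (upd t r j).
Proof. by move=> st ij r'; rewrite /upd; case: eqVneq => // /st. Qed.

Lemma block_le_updr s t r j : block_le s t -> (s r <= j)%N -> block_le s (upd t r j).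
Proof. by move=> st sj r'; rewrite /upd; case: eqVneq => // ->. Qed.

Definition block_additive (V : zmodType) (m : ('I_q -> nat) -> ('I_q -> nat) -> V) :=
  forall r s t j, block_le s t -> (s r <= j <= t r)%N ->
    m s t = m s (upd t r j) + m (upd s r j) t.

Definition subadditive_in (T : Type) (Y : ('I_q -> nat) -> ('I_q -> nat) -> T -> R) r :=
  forall s t j w, block_le s t -> (s r <= j <= t r)%N ->
    Y s t w <= Y s (upd t r j) w + Y (upd s r j) t w.

Definition runmax (T : Type) r (Y : ('I_q -> nat) -> ('I_q -> nat) -> T -> R) s t w : R :=
  \big[Num.max/0]_(s r <= j < (t r).+1) Y s (upd t r j) w.

Definition runmaxs (T : Type) (rs : seq 'I_q)
  (Y : ('I_q -> nat) -> ('I_q -> nat) -> T -> R) := foldr (@runmax T) Y rs.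

(** This is what allows the one-dimensional inequality to be applied to one
    coordinate after another: a running maximum along [r] does not destroy the
    subadditivity along the coordinates that are still to be treated. *)
Lemma runmax_subadd (T : Type) Y r r' : (forall s t (w : T), 0 <= Y s t w) ->
  r' != r -> subadditive_in Y r' -> subadditive_in (runmax r Y) r'.
Proof.
move=> Y0 rr' Ysub s t j w st sjt; rewrite /runmax.
apply: bigmax_nat_le; first by rewrite addr_ge0 ?bigmax_ge0.
move=> l slt.
have rr'2 : r != r' by rewrite eq_sym.
have -> : (upd t r' j) r = t r by rewrite /upd (negPf rr'2).
have -> : (upd s r' j) r = s r by rewrite /upd (negPf rr'2).
apply: le_trans (Ysub s (upd t r l) j w _ _) _.
- by apply: block_le_updr => //; case/andP: slt.
- by rewrite /upd (negPf rr').
rewrite updC// lerD//.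
- exact: (bigmax_nat_ub (fun l => Y s (upd (upd t r' j) r l) w)).
- exact: (bigmax_nat_ub (fun l => Y (upd s r' j) (upd t r l) w)).
Qed.

Lemma runmaxs_ub (T : Type) rs Y s t u (w : T) : block_le s u -> block_le u t ->
  (forall r, r \notin rs -> u r = t r) -> Y s u w <= runmaxs rs Y s t w.
Proof.
elim: rs t => [|r rs IH] t su ut hut.
  by have -> : u = t by apply/funext => r; exact: hut.
rewrite /=; apply: (@le_trans _ _ (runmaxs rs Y s (upd t r (u r)) w)).
  apply: IH => //.
    by move=> i; rewrite /upd; case: eqVneq => // ->.
  move=> i irs; rewrite /upd; case: eqVneq => [->//|ir].
  by apply: hut; rewrite in_cons (negPf ir).
apply: (bigmax_nat_ub (fun l => runmaxs rs Y s (upd t r l) w)).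
by rewrite su ut.
Qed.

Section maximal_inequality.
Context d (T : measurableType d) (P : probability T R).

(** Iteration of the one-dimensional inequality over all coordinates. After
    some coordinates have been treated, the running maximum along them plays
    the role of [Y] in the next one; each step costs a factor [K]. *)
Lemma maximal_inequality (alpha : R) : 1 < alpha -> exists2 K : R, 1 <= K &
  forall (Y : ('I_q -> nat) -> ('I_q -> nat) -> T -> R)
    (m : ('I_q -> nat) -> ('I_q -> nat) -> R),
  (forall s t, measurable_fun setT (Y s t)) ->
  (forall s t w, 0 <= Y s t w) ->
  (forall r, subadditive_in Y r) ->
  (forall s t, block_le s t -> 0 <= m s t) ->
  block_additive m ->
  (forall s t, block_le s t -> (moment4 P (Y s t) <= (m s t `^ alpha)%:E)%E) ->
  forall s t, block_le s t ->
    (moment4 P (runmaxs (enum 'I_q) Y s t) <= (K * m s t `^ alpha)%:E)%E.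
Proof.
move=> /(maximal_inequality_1d P)[K K1 hK].
have K0 : 0 <= K by rewrite (le_trans _ K1).
exists (K ^+ size (enum 'I_q)); first exact: exprn_ege1.
move=> Y m mY Y0 Ysub m0 madd hY.
suff H rs : uniq rs -> [/\ (forall s t, measurable_fun setT (runmaxs rs Y s t)),
    (forall s t w, 0 <= runmaxs rs Y s t w),
    (forall r, r \notin rs -> subadditive_in (runmaxs rs Y) r) &
    (forall s t, block_le s t ->
      (moment4 P (runmaxs rs Y s t) <= (K ^+ size rs * m s t `^ alpha)%:E)%E)].
  by have [] := H _ (enum_uniq 'I_q).
elim: rs => [_|r rs IH /= /andP[rrs /IH[mZ Z0 Zsub hZ]]].
  by split => //= s t st; rewrite expr0 mul1r; exact: hY.
set Z := runmaxs rs Y in mZ Z0 Zsub hZ *.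
split.
- by move=> s t; exact: measurable_bigmax.
- by move=> s t w; exact: bigmax_ge0.
- move=> r'; rewrite in_cons negb_or => /andP[rr' r'rs].
  by apply: runmax_subadd => //; exact: Zsub.
move=> s t st.
have block_le' i j : (i <= j)%N -> block_le (upd s r i) (upd t r j).
  by apply: block_le_upd => r' _; exact: st.
have := hK (fun i j => Z (upd s r i) (upd t r j))
  (fun i j => m (upd s r i) (upd t r j)) (K ^+ size rs).
rewrite exprS.
move=> /(_ _ _ _ _ _ _ _ (s r) (t r) (st r)); rewrite !upd_id; apply => //.
- exact: exprn_ge0.
- move=> i j k w /andP[ij jk].
  have := Zsub r rrs (upd s r i) (upd t r k) j w.
  rewrite !updK !upd_same ij jk; apply => //.
  by apply: block_le'; exact: leq_trans jk.
- by move=> i j ij; apply: m0; exact: block_le'.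
- move=> i j k /andP[ij jk].
  have := madd r (upd s r i) (upd t r k) j.
  rewrite !updK !upd_same ij jk; apply => //.
  by apply: block_le'; exact: leq_trans jk.
- by move=> i j ij; apply: hZ; exact: block_le'.
Qed.
End maximal_inequality.
End blocks.

(** * Increments around rectangles *)

Section increments.
Context (R : realType) (q : nat) (T : Type).
Implicit Types (Y : ('I_q -> \bar R) -> T -> R) (s t : 'I_q -> \bar R).
Implicit Types (e : {ffun 'I_q -> bool}).

Definition corner (A : Type) (s t : 'I_q -> A) e : 'I_q -> A :=
  fun r => if e r then t r else s r.

Definition corner_sign e : R := (-1) ^+ (q - \sum_r e r).

Definition flip (r : 'I_q) e : {ffun 'I_q -> bool} :=
  [ffun i => if i == r then ~~ e i else e i].

Lemma flipK r : involutive (flip r).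
Proof. by move=> e; apply/ffunP => i; rewrite !ffunE; case: eqP => // _; rewrite negbK. Qed.

(** In this product form the effect of changing one coordinate of the corner is
    visible. *)
Lemma corner_signE e : corner_sign e = \prod_r (-1) ^+ (~~ e r).
Proof.
rewrite /corner_sign -expr_sum; congr (_ ^+ _).
apply/eqP; rewrite -(eqn_add2r (\sum_r e r)) subnK; last first.
  by rewrite -[leqRHS]card_ord -sum1_card leq_sum// => i _; case: (e i).
rewrite -big_split/= -[eqbLHS]card_ord -sum1_card; apply/eqP.
by apply: eq_bigr => i _; case: (e i).
Qed.

Lemma corner_sign_flip r e : corner_sign (flip r e) = - corner_sign e.
Proof.
rewrite !corner_signE (bigD1 r)//= [in RHS](bigD1 r)//= ffunE eqxx.
rewrite (eq_bigr (fun i => (-1) ^+ (~~ e i))) => [|i ir].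
  by case: (e r); rewrite ?expr0 ?expr1 ?mul1r ?mulN1r ?opprK.
by rewrite ffunE (negPf ir).
Qed.

Lemma sum_flip r (F : {ffun 'I_q -> bool} -> R) :
  \sum_e F e = \sum_(e : {ffun 'I_q -> bool} | e r) (F e + F (flip r e)).
Proof.
rewrite (bigID (fun e : {ffun 'I_q -> bool} => e r))/= big_split/=; congr (_ + _).
rewrite (reindex_inj (inv_inj (flipK r)))/=.
by apply: eq_bigl => e; rewrite ffunE eqxx negbK.
Qed.

(** An increment is a difference in coordinate [r], summed over the faces
    orthogonal to that coordinate. Additivity and the vanishing on degenerate
    rectangles can be read off. *)
Lemma incrementE r Y s t w : increment Y s t w =
  \sum_(e : {ffun 'I_q -> bool} | e r) corner_sign e *
    (Y (upd (corner s t e) r (t r)) w - Y (upd (corner s t e) r (s r)) w).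
Proof.
rewrite /increment (sum_flip r); apply: eq_bigr => e er.
rewrite -/(corner_sign e) -/(corner_sign _) corner_sign_flip mulrBr mulNr.
congr (_ * Y _ w - _ * Y _ w); apply/funext => i; rewrite /upd/corner ?ffunE.
  by case: eqVneq => // ->; rewrite er.
by case: eqVneq => // ->; rewrite er.
Qed.

Lemma increment_degenerate r Y s t w : s r = t r -> increment Y s t w = 0.
Proof. by move=> st; rewrite (incrementE r) st big1// => e _; rewrite subrr mulr0. Qed.

Lemma increment_split r x Y s t w :
  increment Y s t w = increment Y s (upd t r x) w + increment Y (upd s r x) t w.
Proof.
rewrite !(incrementE r) -big_split/=; apply: eq_bigr => e er.
have E1 y : upd (corner s (upd t r x) e) r y = upd (corner s t e) r y.
  by apply/funext => i; rewrite /upd /corner; case: eqVneq.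
have E2 y : upd (corner (upd s r x) t e) r y = upd (corner s t e) r y.
  by apply/funext => i; rewrite /upd /corner; case: eqVneq.
by rewrite !E1 !E2 !upd_same -mulrDr; congr (_ * _); ring.
Qed.

(** The signs of the corners sum to 0, so the common value of the process on the
    lower boundary may be subtracted at every corner; then only the upper
    corner contributes. *)
Lemma increment_lower_boundary Y t w : (0 < q)%N -> constant_on_lower_boundary Y ->
  increment Y (fun=> -oo%E) t w = Y t w - Y (fun=> -oo%E) w.
Proof.
move=> q0 Yc; pose r := Ordinal q0.
have S0 : \sum_e corner_sign e = 0 :> R.
  by rewrite (sum_flip r) big1// => e _; rewrite corner_sign_flip subrr.
transitivity (\sum_e corner_sign e *
    (Y (corner (fun=> -oo%E) t e) w - Y (fun=> -oo%E) w)).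
  under [RHS]eq_bigr do rewrite mulrBr.
  by rewrite sumrB -mulr_suml S0 mul0r subr0.
rewrite (bigD1 [ffun=> true])//= [X in _ + X]big1 ?addr0.
  rewrite corner_signE big1 => [|i _]; last by rewrite ffunE expr0.
  rewrite mul1r; congr (Y _ w - _); apply/funext => i.
  by rewrite /corner ffunE.
move=> e e1; suff [i ei] : exists i, ~~ e i.
  rewrite (Yc (corner _ _ _)) ?subrr ?mulr0//.
  by exists i; rewrite /corner (negPf ei).
apply/existsP; apply: contraNT e1; rewrite negb_exists => /forallP eT.
by apply/eqP/ffunP => i; rewrite ffunE; have := eT i; rewrite negbK.
Qed.
End increments.

Section block_increments.
Context (R : realType) (q : nat).

(** The region between the nested rectangles with upper corners [t] and [b] is
    peeled off coordinate by coordinate. The piece removed in coordinate [r]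
    lies above level [t r]; it is the difference of two rectangles whose lower
    side in that coordinate is the level [a r], whence the factor 2. Thus only
    suprema over rectangles with a lower corner not depending on [t] are
    needed, as a maximal inequality provides. *)
Lemma block_telescope (D : ('I_q -> nat) -> ('I_q -> nat) -> R)
    (z a t b : 'I_q -> nat) (W : 'I_q -> R) :
  block_additive D -> block_le z a -> block_le a t -> block_le t b ->
  (forall r u, block_le (upd z r (a r)) u -> block_le u b -> `|D (upd z r (a r)) u| <= W r) ->
  `|D z b - D z t| <= \sum_r 2 * W r.
Proof.
move=> hD za at_ tb hW.
have ab : block_le a b by move=> r; exact: leq_trans (at_ r) (tb r).
(* The corner reached when the coordinates in rs have been treated. *)
pose u (rs : seq 'I_q) i := if i \in rs then t i else b i.
have au rs : block_le a (u rs) by move=> i; rewrite /u; case: ifP.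
have ub rs : block_le (u rs) b by move=> i; rewrite /u; case: ifP.
have zu rs : block_le z (u rs) by move=> i; exact: leq_trans (za i) (au rs i).
have step rs : `|D z b - D z (u rs)| <= \sum_(r <- rs) 2 * W r.
  elim: rs => [|r rs IH].
    by rewrite (_ : u [::] = b)// subrr normr0 big_nil.
  have uE : u (r :: rs) = upd (u rs) r (t r).
    apply/funext => i; rewrite /u /upd in_cons.
    by case: eqVneq => [->|].
  have ut : (t r <= u rs r)%N by rewrite /u; case: ifP.
  have azr : block_le (upd z r (a r)) (u rs).
    by move=> i; rewrite /upd; case: eqVneq => [->|_]; [exact: au|exact: zu].
  have -> : D z b - D z (u (r :: rs)) =
      (D z b - D z (u rs)) + (D (upd z r (a r)) (u rs) -
       D (upd z r (a r)) (u (r :: rs))).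
    rewrite (hD r z (u rs) (t r)) ?(leq_trans (za r) (at_ r)) ?ut//.
    rewrite (hD r (upd z r (a r)) (u rs) (t r)) ?upd_same ?at_ ?ut//.
    by rewrite updK -uE; ring.
  rewrite big_cons addrC (le_trans (ler_normD _ _))// lerD//.
  rewrite mulr_natl mulr2n (le_trans (ler_normB _ _))// lerD//; apply: hW => //.
  move=> i; rewrite uE /upd; case: eqVneq => [_ //|_].
  by move: (zu rs i).
have := step (enum 'I_q); rewrite big_enum.
suff -> : u (enum 'I_q) = t by [].
by apply/funext => i; rewrite /u mem_enum.
Qed.

Definition block_increment (T : Type) (Y : ('I_q -> \bar R) -> T -> R)
    (g : 'I_q -> nat -> \bar R) (s t : 'I_q -> nat) (w : T) : R :=
  increment Y (gridpt g s) (gridpt g t) w.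

Lemma gridpt_upd (g : 'I_q -> nat -> \bar R) k r j :
  gridpt g (upd k r j) = upd (gridpt g k) r (g r j).
Proof. by apply/funext => i; rewrite /gridpt /upd; case: eqVneq => // ->. Qed.

Lemma block_increment_additive (T : Type) (Y : ('I_q -> \bar R) -> T -> R) g w :
  block_additive (fun s t => block_increment Y g s t w).
Proof.
by move=> r s t j _ _; rewrite /block_increment !gridpt_upd; exact: increment_split.
Qed.
End block_increments.

(** * Rectangles, strips and marginal distribution functions *)

Section borel.
Context (R : realType) (q : nat).
Implicit Types (r : 'I_q) (a b c : \bar R).

Lemma measurable_open (U : set 'rV[R]_q) :
  open U -> measurable (U : set (borelRq R q)).
Proof. exact: sub_sigma_algebra. Qed.

Lemma measurable_coord r :
  measurable_fun setT (fun x : borelRq R q => (x : 'rV[R]_q) ord0 r).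
Proof.
apply: (measurability _ (RGenOpens.measurableE R)).
move=> _ [_ [a [b ->]] <-]; rewrite setTI; apply: measurable_open.
by apply: open_comp; [move=> x _; exact: coord_continuous|exact: interval_open].
Qed.

Lemma measurable_strip r a b : measurable (strip r a b : set (borelRq R q)).
Proof.
have /measurable_EFinP/(_ measurableT) := measurable_coord r.
move=> /(_ `]a, b]%classic (emeasurable_itv _)).
rewrite setTI; congr (measurable _); apply/seteqP.
Qed.

Lemma hrect_bigcap (s t : 'I_q -> \bar R) :
  hrect s t = \bigcap_(r in setT) strip r (s r) (t r).
Proof. by apply/seteqP; split=> x /=; [move=> xst r _; exact: xst|move=> xst r; exact: xst]. Qed.

Lemma measurable_hrect (s t : 'I_q -> \bar R) :
  measurable (hrect s t : set (borelRq R q)).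
Proof.
rewrite hrect_bigcap; apply: fin_bigcap_measurable => // r _.
exact: measurable_strip.
Qed.

Lemma strip_disjoint r a b c : strip r a b `&` strip r b c = set0 :> set (borelRq R q).
Proof.
by apply/seteqP; split=> x //= -[/andP[_ xb] /andP[/(le_lt_trans xb)]]; rewrite ltxx.
Qed.

Lemma stripU r a b c : (a <= b <= c)%E ->
  strip r a c = strip r a b `|` strip r b c :> set (borelRq R q).
Proof.
move=> /andP[ab bc]; apply/seteqP; split=> x /=.
  by move=> /andP[ax xc]; case: (leP ((x : 'rV[R]_q) ord0 r)%:E b) => xb; [left|right]; apply/andP; split.
move=> [/andP[ax xb]|/andP[bx xc]]; apply/andP; split => //.
  exact: le_trans bc.
exact: le_lt_trans bx.
Qed.

Lemma hrectU r x (s t : 'I_q -> \bar R) : (s r <= x <= t r)%E ->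
  hrect s t = hrect s (upd t r x) `|` hrect (upd s r x) t :> set (borelRq R q).
Proof.
move=> /andP[sx xt]; apply/seteqP; split=> y /=.
  move=> yst; case: (leP ((y : 'rV[R]_q) ord0 r)%:E x) => yx; [left|right] => i;
    rewrite /upd; case: eqVneq => [->|_]; try exact: yst.
    by rewrite yx andbT; case/andP: (yst r).
  by rewrite yx; case/andP: (yst r).
move=> [] yst i; have := yst i; rewrite /upd; case: eqVneq => // ->.
  by move=> /andP[-> yx]; rewrite (le_trans yx).
by move=> /andP[xy ->]; rewrite (le_lt_trans sx).
Qed.

Lemma hrect_disjoint r x (s t : 'I_q -> \bar R) :
  hrect s (upd t r x) `&` hrect (upd s r x) t = set0 :> set (borelRq R q).
Proof.
apply/seteqP; split=> y //= -[/(_ r) + /(_ r)].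
by rewrite !upd_same => /andP[_ yx] /andP[/(le_lt_trans yx)]; rewrite ltxx.
Qed.

Lemma hrect_sub_strip r (s t : 'I_q -> \bar R) : hrect s t `<=` strip r (s r) (t r).
Proof. by move=> x; exact. Qed.
End borel.

Section finite.
Context (R : realType) (q : nat) (m : {measure set (borelRq R q) -> \bar R}).
Hypothesis mfin : (m setT < +oo)%E.
Implicit Types (r : 'I_q) (a b c x : \bar R).

Lemma fin_num_finite A : measurable A -> m A \is a fin_num.
Proof.
move=> mA; rewrite ge0_fin_numE//; apply: le_lt_trans mfin.
by apply: le_measure; rewrite ?inE.
Qed.

(** The marginal distribution function, extended to infinite arguments. *)
Definition marginal r x : R := fine (m (strip r -oo%E x)).

Lemma margE r x : m (strip r -oo%E x) = (marginal r x)%:E.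
Proof. by rewrite fineK//; apply: fin_num_finite; exact: measurable_strip. Qed.

Lemma strip_margE r a b : (a <= b)%E -> m (strip r a b) = (marginal r b - marginal r a)%:E.
Proof.
move=> ab; rewrite EFinB -!margE (@stripU _ _ r -oo%E a b) ?leNye//.
rewrite measureU ?strip_disjoint//; [|exact: measurable_strip..].
rewrite addeAC subee ?add0e// fin_num_finite//; exact: measurable_strip.
Qed.

Lemma marg_le r a b : (a <= b)%E -> marginal r a <= marginal r b.
Proof. by move=> ab; rewrite -subr_ge0 -lee_fin -strip_margE. Qed.

Lemma marg_lt r a b : marginal r a < marginal r b -> (a < b)%E.
Proof. by rewrite !ltNge; apply: contra; exact: marg_le. Qed.

Lemma marg_ninfty r : marginal r -oo%E = 0.
Proof.
rewrite /marginal (_ : strip _ _ _ = set0) ?measure0//.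
by apply/seteqP; split=> y //= /andP[/lt_le_trans /[apply]]; rewrite ltxx.
Qed.

Lemma marg_pinfty r : marginal r +oo%E = fine (m setT).
Proof.
rewrite /marginal (_ : strip _ _ _ = setT)//.
by apply/seteqP; split=> y; rewrite /strip /= ltNyr leey.
Qed.

Lemma marg_ge0 r x : 0 <= marginal r x.
Proof. by rewrite -(marg_ninfty r) marg_le// leNye. Qed.

Lemma marg_le_total r x : marginal r x <= fine (m setT).
Proof. by rewrite -(marg_pinfty r) marg_le// leey. Qed.

Lemma hrect_add r x (s t : 'I_q -> \bar R) : (s r <= x <= t r)%E ->
  fine (m (hrect s t)) = fine (m (hrect s (upd t r x))) + fine (m (hrect (upd s r x) t)).
Proof.
move=> sxt; rewrite (hrectU sxt) measureU ?hrect_disjoint//;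
  [|exact: measurable_hrect..].
by rewrite fineD// fin_num_finite//; exact: measurable_hrect.
Qed.

Lemma fine_hrect_le r (s t : 'I_q -> \bar R) : (s r <= t r)%E ->
  fine (m (hrect s t)) <= marginal r (t r) - marginal r (s r).
Proof.
move=> st; rewrite -lee_fin -strip_margE// fineK; last first.
  by rewrite fin_num_finite//; exact: measurable_hrect.
by apply: le_measure; rewrite ?inE; [exact: measurable_hrect|
  exact: measurable_strip|exact: hrect_sub_strip].
Qed.

Hypothesis mcont : continuous_marginals m.

Lemma marg_continuous r : continuous (fun a : R => marginal r a%:E).
Proof.
have E (a : R) : m [set x : 'rV[R]_q | x ord0 r <= a] = (marginal r a%:E)%:E.
  rewrite -margE; congr (m _); apply/seteqP.
  by split=> x; rewrite /strip /= ltNyr lee_fin.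
move=> a; have := @mcont r a; rewrite /continuous_at E => /fine_cvg.
by apply: cvg_trans; apply: near_eq_cvg; apply: nearW => y /=; rewrite E.
Qed.

Lemma marg_cvgNy r : marginal r (- n%:R)%:E @[n --> \oo] --> 0.
Proof.
have : m (strip r -oo%E (- n%:R)%:E) @[n --> \oo] --> 0%:E.
  pose F n := strip r -oo%E (- n%:R)%:E : set (borelRq R q).
  have F0 : \bigcap_n F n = set0.
    apply/seteqP; split=> x //= Fx.
    have [n xn] : exists n : nat, - x ord0 r < n%:R.
      by exists (Num.bound `|x ord0 r|); rewrite (le_lt_trans (ler_norm _))// normrN archi_boundP.
    have /andP[_] := Fx n I; rewrite lee_fin lerNr => /(lt_le_trans xn).
    by rewrite ltxx.
  have := @nonincreasing_cvg_mu _ _ _ m F _ _ _ _.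
  rewrite F0 measure0; apply => //.
  - by rewrite /F margE ltry.
  - by move=> i; exact: measurable_strip.
  - move=> i j ij; apply/subsetPset => x /andP[x1 x2]; apply/andP; split; rewrite ?ltNyr// (le_trans x2)//.
    by rewrite lee_fin lerN2 ler_nat.
by move/fine_cvg.
Qed.

Lemma marg_cvgy r : marginal r (n%:R)%:E @[n --> \oo] --> fine (m setT).
Proof.
have : m (strip r -oo%E (n%:R)%:E) @[n --> \oo] --> (fine (m setT))%:E.
  pose F n := strip r -oo%E (n%:R)%:E : set (borelRq R q).
  have F0 : \bigcup_n F n = setT.
    apply/seteqP; split=> x //= _.
    exists (Num.bound `|x ord0 r|) => //; rewrite /F /strip /= ltNyr lee_fin.
    by rewrite (le_trans (ler_norm _))// ltW// archi_boundP.
  have := @nondecreasing_cvg_mu _ _ _ m F _ _ _.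
  rewrite F0 fineK ?fin_num_finite//; apply => //.
  - by move=> i; exact: measurable_strip.
  - move=> i j ij; apply/subsetPset => x /andP[x1 x2]; apply/andP; split; rewrite ?ltNyr// (le_trans x2)//.
    by rewrite lee_fin ler_nat.
by move/fine_cvg.
Qed.

Lemma marg_level r v : 0 <= v <= fine (m setT) -> exists x, marginal r x = v.
Proof.
case/andP; rewrite le_eqVlt => /predU1P[<- _|v0].
  by exists -oo%E; exact: marg_ninfty.
rewrite le_eqVlt => /predU1P[->|v1].
  by exists +oo%E; exact: marg_pinfty.
have [i _ /(_ i (leqnn i))/= iv] := cvgr_lt _ (marg_cvgNy r) _ v0.
have [j _ /(_ j (leqnn j))/= vj] := cvgr_gt _ (marg_cvgy r) _ v1.
have ij : - i%:R <= j%:R :> R by rewrite (@le_trans _ _ 0)// oppr_le0.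
have [] := @IVT R (fun a : R => marginal r a%:E) _ _ v ij.
- by apply: continuous_subspaceT; exact: marg_continuous.
- by rewrite ge_min le_max (ltW iv) (ltW vj) orbT.
by move=> c _ <-; exists c%:E.
Qed.
End finite.

(** * Convergence of the marginal distribution functions *)

Section weak.
Context (R : realType) (q : nat).

(** A continuous function between the indicators of ]-oo, b] and ]-oo, b + e]. *)
Definition ramp (b e y : R) : R := Num.max 0 (Num.min 1 ((b + e - y) / e)).

Lemma ramp_bounds b e y : 0 < e -> 0 <= ramp b e y <= 1.
Proof. by move=> e0; rewrite le_max lexx/= ge_max ler01/= ge_min lexx. Qed.

Lemma ramp_eq1 b e y : 0 < e -> y <= b -> ramp b e y = 1.
Proof.
move=> e0 yb; rewrite /ramp min_l ?max_r//.
by rewrite ler_pdivlMr// mul1r; lra.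
Qed.

Lemma ramp_eq0 b e y : 0 < e -> b + e < y -> ramp b e y = 0.
Proof.
move=> e0 yb; rewrite /ramp max_l// ge_min; apply/orP; right.
by rewrite pmulr_lle0 ?invr_gt0//; lra.
Qed.

Lemma ramp_continuous b e : continuous (ramp b e).
Proof.
have lin : continuous (fun y => (b + e - y) / e : R).
  move=> y; apply: cvgM; last exact: cvg_cst.
  by apply: cvgB; [exact: cvg_cst|exact: cvg_id].
have c1 (c : R) : continuous (fun _ : R => c) by move=> y; exact: cvg_cst.
move=> y.
exact: (continuous_max (c1 0 y) (continuous_min (c1 1 y) (lin y))).
Qed.

Definition rampRq (r : 'I_q) (b e : R) (x : 'rV[R]_q) : R := ramp b e (x ord0 r).

Lemma rampRq_continuous r b e : continuous (rampRq r b e).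
Proof.
move=> x.
apply: (@continuous_comp _ _ _ (fun x : 'rV[R]_q => x ord0 r) (ramp b e)); first exact: coord_continuous.
exact: ramp_continuous.
Qed.

Lemma rampRq_measurable r b e :
  measurable_fun setT (fun x : borelRq R q => (rampRq r b e x)%:E).
Proof.
apply/measurable_EFinP.
apply: (measurableT_comp (continuous_measurable_fun (@ramp_continuous b e))).
exact: measurable_coord.
Qed.

Lemma marg_ramp (m : {measure set (borelRq R q) -> \bar R}) r b e : 0 < e ->
  (m setT < +oo)%E ->
  marginal m r b%:E <= fine (\int[m]_(x in setT) (rampRq r b e x)%:E)%E <= marginal m r (b + e)%:E.
Proof.
move=> e0 mfin.
have mS (a : R) : measurable (strip r -oo%E a%:E : set (borelRq R q)).
  exact: measurable_strip.
have lo : (m (strip r -oo%E b%:E) <= \int[m]_(x in setT) (rampRq r b e x)%:E)%E.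
  rewrite -(setIT (strip r -oo%E b%:E)) -integral_indic//; apply: ge0_le_integral => //.
  - exact/measurable_EFinP/measurable_indic.
  - exact: rampRq_measurable.
  - move=> x _; rewrite lee_fin indicE; case: (boolP (x \in _)) => xb/=.
      by move: xb; rewrite inE /strip/= ltNyr lee_fin => xb; rewrite /rampRq ramp_eq1.
    by have /andP[] := @ramp_bounds b e ((x : 'rV[R]_q) ord0 r) e0.
have hi : (\int[m]_(x in setT) (rampRq r b e x)%:E <= m (strip r -oo%E (b + e)%:E))%E.
  rewrite -(setIT (strip r -oo%E (b + e)%:E)) -integral_indic//; apply: ge0_le_integral => //.
  - by move=> x _; rewrite lee_fin; have /andP[] := @ramp_bounds b e ((x : 'rV[R]_q) ord0 r) e0.
  - exact: rampRq_measurable.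
  - exact/measurable_EFinP/measurable_indic.
  - move=> x _; rewrite lee_fin indicE; case: (boolP (x \in _)) => xb/=.
      by have /andP[] := @ramp_bounds b e ((x : 'rV[R]_q) ord0 r) e0.
    by move: xb; rewrite notin_setE /strip/= ltNyr lee_fin => /negP; rewrite -ltNge => xb; rewrite /rampRq ramp_eq0.
have If : (\int[m]_(x in setT) (rampRq r b e x)%:E)%E \is a fin_num.
  rewrite ge0_fin_numE; first by rewrite (le_lt_trans hi)// margE// ltry.
  exact: le_trans lo.
by rewrite -!lee_fin (fineK If) -!(margE mfin) lo hi.
Qed.

Context (mu_ : nat -> {measure set (borelRq R q) -> \bar R}).
Context (mu : {measure set (borelRq R q) -> \bar R}).
Hypothesis mufin : (mu setT < +oo)%E.
Hypothesis hweak : converges_weakly mu_ mu.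

Lemma weak_cvg_mass : mu_ n setT @[n --> \oo] --> mu setT.
Proof.
have int1 (m : {measure set (borelRq R q) -> \bar R}) :
    (\int[m]_(x in setT) (cst 1 x)%:E)%E = m setT.
  have := integral_cst m (@measurableT _ (borelRq R q)) 1%E.
  by rewrite mul1e.
rewrite -(int1 mu) (funext (fun n => esym (int1 (mu_ n)))).
apply: (@hweak (cst 1)); first exact: cst_continuous.
by exists 1 => x; rewrite normr1.
Qed.

Lemma weak_near_finite : \forall n \near \oo, (mu_ n setT < +oo)%E.
Proof.
have fmu : mu setT \is a fin_num by rewrite ge0_fin_numE.
have := weak_cvg_mass; rewrite -(fineK fmu) => /fine_cvgP[+ _].
by apply: filterS => n /fin_numPlt/andP[].
Qed.

Hypothesis mucont : continuous_marginals mu.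

(** The part of the portmanteau theorem that is needed: the continuity of the
    limit marginal makes every half-space a continuity set. *)
Lemma weak_cvg_marg r x : marginal (mu_ n) r x @[n --> \oo] --> marginal mu r x.
Proof.
case: x => [b| |].
- have rampcvg (a e : R) : 0 < e ->
      fine (\int[mu_ n]_(x in setT) (rampRq r a e x)%:E)%E @[n --> \oo] -->
      fine (\int[mu]_(x in setT) (rampRq r a e x)%:E)%E.
    move=> e0; have [lo hi] := andP (marg_ramp r a e0 mufin).
    apply/fine_cvg; rewrite fineK.
      apply: hweak; first exact: rampRq_continuous.
      exists 1 => x; have /andP[x0 x1] := @ramp_bounds a e (x ord0 r) e0.
      by rewrite ger0_norm.
    rewrite ge0_fin_numE; last first.
      apply: integral_ge0 => x _; rewrite lee_fin.
      by have /andP[] := @ramp_bounds a e ((x : 'rV[R]_q) ord0 r) e0.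
    apply: (@le_lt_trans _ _ (\int[mu]_(x in setT) (cst 1%:E x))%E).
      apply: ge0_le_integral => //.
      + move=> x _; rewrite lee_fin.
        by have /andP[] := @ramp_bounds a e ((x : 'rV[R]_q) ord0 r) e0.
      + exact: rampRq_measurable.
      + move=> x _; rewrite lee_fin.
        by have /andP[] := @ramp_bounds a e ((x : 'rV[R]_q) ord0 r) e0.
    by rewrite integral_cst// mul1e.
  apply/cvgrPdist_lt => /= ep ep0.
  have ep20 : 0 < ep / 2 by rewrite divr_gt0.
  have := @marg_continuous _ _ _ mufin mucont r b.
  move=> /cvgrPdist_lt/(_ _ ep20)/nbhs_ballP[e /= e0 he].
  have e20 : 0 < e / 2 by rewrite divr_gt0.
  have h1 : marginal mu r (b + e / 2)%:E < marginal mu r b%:E + ep / 2.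
    have /he : ball b e (b + e / 2).
      by rewrite /ball/= opprD addrA subrr add0r normrN gtr0_norm//; lra.
    by rewrite /= distrC ltr_distl => /andP[].
  have h2 : marginal mu r b%:E - ep / 2 < marginal mu r (b - e / 2)%:E.
    have /he : ball b e (b - e / 2).
      by rewrite /ball/= opprB addrC subrK gtr0_norm//; lra.
    by rewrite /= distrC ltr_distl => /andP[].
  (* The ramps down from b and up to b squeeze the marginal at b. *)
  have /cvgrPdist_lt/(_ _ ep20) c1 := rampcvg b _ e20.
  have /cvgrPdist_lt/(_ _ ep20) c2 := rampcvg (b - e / 2) _ e20.
  near=> n.
  have nfin : (mu_ n setT < +oo)%E by near: n; exact: weak_near_finite.
  have k1 : `|fine (\int[mu]_(x in setT) (rampRq r b (e / 2) x)%:E)%E -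
     fine (\int[mu_ n]_(x in setT) (rampRq r b (e / 2) x)%:E)%E| < ep / 2.
    by near: n; exact: c1.
  have k2 : `|fine (\int[mu]_(x in setT) (rampRq r (b - e / 2) (e / 2) x)%:E)%E -
     fine (\int[mu_ n]_(x in setT) (rampRq r (b - e / 2) (e / 2) x)%:E)%E| < ep / 2.
    by near: n; exact: c2.
  have /andP[u1 u2] := marg_ramp r b e20 mufin.
  have /andP[u3 u4] := marg_ramp r b e20 nfin.
  have /andP[u5 u6] := marg_ramp r (b - e / 2) e20 mufin.
  have /andP[u7 u8] := marg_ramp r (b - e / 2) e20 nfin.
  rewrite subrK in u6 u8.
  move: k1 k2; rewrite !ltr_distl => /andP[k1 k2] /andP[k3 k4].
  by apply/andP; split; lra.
- rewrite marg_pinfty.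
  under eq_fun do rewrite marg_pinfty.
  by apply/fine_cvg; rewrite fineK ?ge0_fin_numE//; exact: weak_cvg_mass.
- rewrite marg_ninfty.
  under eq_fun do rewrite marg_ninfty.
  exact: cvg_cst.
Unshelve. all: by end_near. Qed.
End weak.

(** * Coarse and fine grids *)

Section grids.
Context (R : realType) (q : nat) (m : {measure set (borelRq R q) -> \bar R}).
Hypothesis mfin : (m setT < +oo)%E.
Hypothesis mcont : continuous_marginals m.

Lemma marg_levels (v : 'I_q -> nat -> R) :
  (forall r k, 0 <= v r k <= fine (m setT)) ->
  exists c : 'I_q -> nat -> \bar R, forall r k, marginal m r (c r k) = v r k.
Proof.
move=> hv.
have /choice[c hc] : forall p : 'I_q * nat, exists x, marginal m p.1 x = v p.1 p.2.
  by move=> p; exact: marg_level.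
by exists (fun r k => c (r, k)) => r k; exact: hc (r, k).
Qed.

(** The quantiles of the marginals cut the space, in each coordinate, into [M]
    strips of equal mass. *)
Lemma coarse_grid M : (0 < M)%N -> 0 < fine (m setT) ->
  exists b : 'I_q -> nat -> \bar R,
    [/\ forall r, b r 0%N = -oo%E,
        forall r j, (M <= j)%N -> b r j = +oo%E &
        forall r j, (j <= M)%N -> marginal m r (b r j) = fine (m setT) * (j%:R / M%:R)].
Proof.
move=> M0 m0; pose v (r : 'I_q) j := fine (m setT) * ((minn j M)%:R / M%:R).
have M0' : 0 < M%:R :> R by rewrite ltr0n.
have [r j|c hc] := @marg_levels v.
  rewrite /v mulr_ge0 ?divr_ge0 ?(ltW m0)//= ger_pMr//.
  by rewrite ler_pdivrMr// mul1r ler_nat geq_minr.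
exists (fun r j => if (j == 0)%N then -oo%E else if (M <= j)%N then +oo%E else c r j).
split => [r|r j Mj|r j jM].
- by rewrite eqxx.
- by rewrite Mj gtn_eqF// (leq_trans M0).
- case: eqVneq => [->|j0]; first by rewrite marg_ninfty mul0r mulr0.
  case: ifPn => Mj.
    have -> : j = M by apply/eqP; rewrite eqn_leq jM.
    by rewrite marg_pinfty divff ?mulr1// gt_eqF.
  by rewrite hc /v (minn_idPl jM).
Qed.

(** Each coarse strip is cut into the same number [K] of strips of equal mass.
    Having the same [K] everywhere gives all coordinates the same number of
    points and puts the coarse points at the indices that are multiples of [K],
    independently of the coordinate. Distinct levels of the marginal
    distribution function force the points to be strictly increasing. Beyond
    the last index the sequence is continued by +oo, so that it is monotone
    without restriction. *)
Lemma fine_grid M K (b : 'I_q -> nat -> \bar R) : (0 < K)%N ->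
  (forall r j, (M <= j)%N -> b r j = +oo%E) ->
  (forall r j, (j < M)%N -> marginal m r (b r j) < marginal m r (b r j.+1)) ->
  exists g : 'I_q -> nat -> \bar R,
    [/\ forall r j, (j <= M)%N -> g r (j * K)%N = b r j,
        forall r, {homo g r : j k / (j <= k)%N >-> (j <= k)%E},
        increasing_axes (M * K).+1 g &
        forall r k, (k < M * K)%N ->
          marginal m r (g r k.+1) - marginal m r (g r k) =
          (marginal m r (b r (k %/ K)%N.+1) - marginal m r (b r (k %/ K)%N)) / K%:R].
Proof.
move=> K0 bM blt.
have K0' : 0 < K%:R :> R by rewrite ltr0n.
have ble r j : marginal m r (b r j) <= marginal m r (b r j.+1).
  have [/blt/ltW//|Mj] := ltnP j M.
  by rewrite !bM// (leq_trans Mj).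
pose v r k : R := marginal m r (b r (k %/ K)%N) +
  (k %% K)%N%:R / K%:R * (marginal m r (b r (k %/ K)%N.+1) - marginal m r (b r (k %/ K)%N)).
have [r k|c hc] := @marg_levels v.
  have h1 := marg_ge0 mfin r (b r (k %/ K)%N).
  have h2 := marg_le_total mfin r (b r (k %/ K)%N.+1).
  have h3 := ble r (k %/ K)%N.
  have l1 : (k %% K)%N%:R / K%:R <= 1 :> R.
    by rewrite ler_pdivrMr// mul1r ler_nat ltnW// ltn_mod.
  have l0 : 0 <= (k %% K)%N%:R / K%:R :> R by rewrite divr_ge0.
  by rewrite /v; nra.
(* At multiples of K the levels are those of the coarse points, but the
   points must be these, and not others with the same level. *)
pose g r k := if (K %| k)%N then b r (k %/ K)%N else c r k.
have gv r k : marginal m r (g r k) = v r k.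
  rewrite /g; case: ifPn => [/eqP Kk|_]; last exact: hc.
  by rewrite /v Kk mul0r mul0r addr0.
have vS r k : v r k.+1 - v r k =
    (marginal m r (b r (k %/ K)%N.+1) - marginal m r (b r (k %/ K)%N)) / K%:R.
  have [Kk|Kk] := boolP (K %| k.+1)%N.
    have kK : (k %% K = K.-1)%N.
      have /dvdnP[[//|e] kE] := Kk.
      have -> : k = (e * K + K.-1)%N by move: kE K0; clear; nia.
      by rewrite modnMDl modn_small// prednK.
    rewrite /v divnS// Kk add1n (eqP Kk) kK.
    have -> : K.-1%:R = K%:R - 1 :> R by rewrite -subn1 natrB.
    by field; rewrite gt_eqF.
  rewrite /v divnS// (negPf Kk) add0n modnS (negPf Kk) -natr1.
  by field; rewrite gt_eqF.
have glt r k : (k < M * K)%N -> marginal m r (g r k) < marginal m r (g r k.+1).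
  move=> kMK; rewrite -subr_gt0 !gv vS divr_gt0// subr_gt0 blt//.
  by rewrite ltn_divLR.
pose h r k := g r (minn k (M * K)).
have hlt r j k : (j < k <= M * K)%N -> (h r j < h r k)%E.
  move=> /andP[]; elim: k => // k IH; rewrite ltnS leq_eqVlt => /predU1P[->|jk] kM.
    by apply: (marg_lt mfin (r := r)); rewrite /h (minn_idPl kM) (minn_idPl (ltnW kM)) glt.
  apply: lt_trans (IH jk (ltnW kM)) _.
  by apply: (marg_lt mfin (r := r)); rewrite /h (minn_idPl kM) (minn_idPl (ltnW kM)) glt.
exists h; split.
- move=> r j jM; rewrite /h (minn_idPl _) ?leq_pmul2r//.
  by rewrite /g dvdn_mull// mulnK.
- move=> r j k jk; have [kM|/ltnW Mk] := leqP k (M * K).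
    have [->//|jk'] := eqVneq j k.
    by apply/ltW/hlt; rewrite ltn_neqAle jk' jk.
  have hM : h r (M * K)%N = +oo%E.
    by rewrite /h minnn /g dvdn_mull// mulnK// bM.
  have -> : h r k = +oo%E by rewrite -hM /h (minn_idPr Mk) minnn.
  exact: leey.
- by move=> r j k /andP[jk]; rewrite ltnS => kM; apply: hlt; rewrite jk.
- move=> r k kM; rewrite /h (minn_idPl kM) (minn_idPl (ltnW kM)).
  by rewrite !gv vS.
Qed.
End grids.

(** * Moments of increments on a grid *)

Section oscillation.
Context (R : realType) (q : nat) d (T : measurableType d) (P : probability T R).

Lemma measurable_increment (X : ('I_q -> \bar R) -> {RV P >-> R}) s t :
  measurable_fun setT (fun w => increment (fun x v => X x v) s t w).
Proof.
apply: measurable_sum => e; apply: measurable_funM; first exact: measurable_cst.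
exact: measurable_funP.
Qed.

Lemma measurable_max_osc (X : ('I_q -> \bar R) -> {RV P >-> R}) M b N g :
  measurable_fun setT (fun w => max_osc (fun x v => X x v) M b N g w).
Proof.
apply: measurable_bigmax => i; apply: measurable_bigmax => k.
apply: measurableT_comp => //.
by apply: measurable_funB; exact: measurable_funP.
Qed.

Lemma block_count_additive :
  block_additive (fun s t : 'I_q -> nat => \prod_r (t r - s r)%N%:R : R).
Proof.
move=> r s t j st /andP[sj jt].
rewrite (bigD1 r)//= [X in _ = X + _](bigD1 r)//= [X in _ = _ + X](bigD1 r)//= !upd_same.
set p := \prod_(i | _) _.
rewrite (_ : \prod_(i | i != r) ((upd t r j i - s i)%N%:R) = p); last first.
  by apply: eq_bigr => i ir; rewrite /upd (negPf ir).
rewrite (_ : \prod_(i | i != r) ((t i - upd s r j i)%N%:R) = p); last first.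
  by apply: eq_bigr => i ir; rewrite /upd (negPf ir).
rewrite -mulrDl -natrD; congr (_%:R * _).
by rewrite addnC addnBA// subnK.
Qed.

Lemma block_additiveD (f g : ('I_q -> nat) -> ('I_q -> nat) -> R) (c : R) :
  block_additive f -> block_additive g ->
  block_additive (fun s t => f s t + c * g s t).
Proof.
by move=> hf hg r s t j st sjt; rewrite (hf r s t j)// (hg r s t j)//; ring.
Qed.

(** On a grid, the error term [c] of the moment condition is absorbed in an
    additive set function: every nondegenerate block contains at least one
    cell, so that [c] is at most [c] times the number of cells. *)
Definition block_mass (m : {measure set (borelRq R q) -> \bar R}) (c : R)
    (g : 'I_q -> nat -> \bar R) (s t : 'I_q -> nat) : R :=
  fine (m (hrect (gridpt g s) (gridpt g t))) + c * \prod_r (t r - s r)%N%:R.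

Lemma block_mass_ge0 m c g s t : 0 <= c -> 0 <= block_mass m c g s t.
Proof. by move=> c0; rewrite addr_ge0 ?fine_ge0 ?mulr_ge0 ?prodr_ge0. Qed.

Lemma block_mass_additive (m : {measure set (borelRq R q) -> \bar R}) c g :
  (m setT < +oo)%E -> (forall r, {homo g r : j k / (j <= k)%N >-> (j <= k)%E}) ->
  block_additive (block_mass m c g).
Proof.
move=> mfin gle; apply: block_additiveD block_count_additive => r s t j st /andP[sj jt].
by rewrite !gridpt_upd; apply: hrect_add => //; rewrite !gle.
Qed.

Lemma block_moment (X : ('I_q -> \bar R) -> {RV P >-> R})
    (m : {measure set (borelRq R q) -> \bar R}) (c alpha : R) g s t :
  (m setT < +oo)%E -> 0 <= c -> 0 <= alpha ->
  (forall r, {homo g r : j k / (j <= k)%N >-> (j <= k)%E}) ->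
  (forall s t : 'I_q -> \bar R, (forall r, (s r <= t r)%E) ->
     ('E_P[fun w => (increment (fun x v => X x v) s t w ^+ 4)%R] <=
      poweR (m (hrect s t) + c%:E) alpha)%E) ->
  block_le s t ->
  (moment4 P (fun w => `|block_increment (fun x v => X x v) g s t w|%R) <=
    (block_mass m c g s t `^ alpha)%:E)%E.
Proof.
move=> mfin c0 a0 gle hmom st.
have moment4E : moment4 P (fun w => `|block_increment (fun x v => X x v) g s t w|%R) =
   ('E_P[fun w => (increment (fun x v => X x v) (gridpt g s) (gridpt g t) w ^+ 4)%R])%E.
  rewrite expectation.unlock; apply: eq_integral => w _.
  by rewrite /block_increment (@exprM _ _ 2 2) real_normK ?num_real// -exprM.
have [[r str]|nst] := pselect (exists r, s r = t r).
  rewrite /moment4 integral0_eq ?lee_fin ?powR_ge0// => w _.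
  rewrite /block_increment (@increment_degenerate _ _ _ r) ?normr0 ?expr0n//.
  by rewrite /gridpt str.
have st1 : 1 <= \prod_r (t r - s r)%N%:R :> R.
  rewrite -natr_prod ler1n prodn_gt0// => r; rewrite subn_gt0 ltn_neqAle st andbT.
  by apply/eqP => str; apply: nst; exists r.
rewrite moment4E; apply: le_trans (hmom _ _ _) _ => [r|]; first exact: gle.
have -> : m (hrect (gridpt g s) (gridpt g t)) = (fine (m (hrect (gridpt g s) (gridpt g t))))%:E.
  by rewrite fineK// fin_num_finite//; exact: measurable_hrect.
rewrite -EFinD poweR_EFin lee_fin le_powR ?addr_ge0 ?fine_ge0//.
by rewrite lerD2l ler_peMr.
Qed.
End oscillation.

(** * Oscillation of the process on a fine grid *)

Section prob_max_osc_le.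
Context (R : realType) (q : nat) d (T : measurableType d) (P : probability T R).
Hypothesis q0 : (0 < q)%N.

Section deterministic.
Context (Y : ('I_q -> \bar R) -> T -> R) (M K : nat).
Context (b g : 'I_q -> nat -> \bar R).
Hypothesis Yc : constant_on_lower_boundary Y.
Hypothesis g0 : forall r, g r 0%N = -oo%E.
Hypothesis gb : forall r j, (j <= M)%N -> g r (j * K)%N = b r j.
Hypothesis glt : increasing_axes (M * K).+1 g.

(** The slab [p] is the set of grid points whose coordinate [p.1] lies between
    two consecutive coarse points, the other coordinates being free. *)
Definition slab_lo (p : 'I_q * 'I_M) : 'I_q -> nat := upd (fun=> 0%N) p.1 (p.2 * K)%N.
Definition slab_hi (p : 'I_q * 'I_M) : 'I_q -> nat :=
  upd (fun=> (M * K)%N) p.1 (p.2.+1 * K)%N.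
Definition slab_max (p : 'I_q * 'I_M) : T -> R :=
  runmaxs (enum 'I_q) (fun s t w => `|block_increment Y g s t w|)
    (slab_lo p) (slab_hi p).

Lemma slab_le p : block_le (slab_lo p) (slab_hi p).
Proof. by apply: block_le_upd => //; rewrite leq_mul2r leqnSn orbT. Qed.

(** Every difference in [max_osc] is a difference of two increments with lower
    corner -oo. By [block_telescope] it splits into one piece for each
    coordinate, and the piece of coordinate [r] lies in a slab orthogonal to
    [r]. *)
Lemma max_osc_le w c : 0 <= c -> (forall p, slab_max p w <= c) ->
  max_osc Y M b (M * K).+1 g w <= q%:R * (2 * c).
Proof.
move=> c0 hc; have qc0 : 0 <= q%:R * (2 * c) by rewrite !mulr_ge0.
apply: bigmax_le => // i _; apply: bigmax_le => // k /forallP hk.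
have le_idx r j l : (j <= M * K)%N -> (l <= M * K)%N -> (g r j <= g r l)%E -> (j <= l)%N.
  move=> jM lM; rewrite leqNgt leNgt; apply: contra => lj.
  by apply: glt; rewrite lj ltnS.
have iM r : ((i r).+1 * K <= M * K)%N by rewrite leq_mul2r ltn_ord orbT.
have kM r : (k r <= M * K)%N by rewrite -ltnS.
have ik r : (i r * K <= k r)%N.
  apply: (le_idx r) => //; first by rewrite leq_mul2r (ltnW (ltn_ord _)) orbT.
  by rewrite gb 1?ltnW//; case/andP: (hk r).
have ki r : (k r <= (i r).+1 * K)%N.
  by apply: (le_idx r) => //; rewrite gb//; case/andP: (hk r).
have -> : gridpt b (fun r => (i r).+1) = gridpt g (fun r => ((i r).+1 * K)%N).
  by apply/funext => r; rewrite /gridpt gb.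
pose D s t := block_increment Y g s t w.
have D0 t : D (fun=> 0%N) t = Y (gridpt g t) w - Y (fun=> -oo%E) w.
  rewrite /D /block_increment -increment_lower_boundary//; congr (increment _ _ _ _).
  by apply/funext => r; rewrite /gridpt g0.
rewrite distrC (_ : _ - _ = D (fun=> 0%N) (fun r => ((i r).+1 * K)%N) - D (fun=> 0%N) (fun r => nat_of_ord (k r))); last first.
  by rewrite !D0; ring.
rewrite (_ : q%:R * (2 * c) = \sum_(r < q) 2 * c); last first.
  by rewrite sumr_const card_ord mulr_natl.
apply: (@block_telescope _ _ _ _ (fun r => (i r * K)%N)) => //.
  exact: block_increment_additive.
move=> r u zu ut; apply: le_trans (hc (r, i r)).
have := @runmaxs_ub R q T (enum 'I_q) (fun s t w => `|block_increment Y g s t w|)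
  (slab_lo (r, i r)) (slab_hi (r, i r)) u w; apply => //.
  move=> r'; rewrite /slab_hi /upd/=; case: eqVneq => [->|_]; first exact: ut.
  exact: leq_trans (ut r') (iM r').
by move=> r'; rewrite mem_enum.
Qed.
End deterministic.

Lemma prob_le_mean (A : set T) (S : T -> R) : measurable A -> measurable_fun setT S ->
  (forall w, 0 <= S w) -> (forall w, A w -> 1 <= S w) ->
  (P A <= \int[P]_w (S w)%:E)%E.
Proof.
move=> mA mS S0 AS; rewrite -(setIT A) -integral_indic//.
apply: ge0_le_integral => //.
- exact/measurable_EFinP/measurable_indic.
- exact/measurable_EFinP.
- move=> w _; rewrite lee_fin indicE; case: (boolP (w \in A)) => //=.
  by rewrite inE => /AS.
Qed.

(** Markov's inequality for the fourth powers of the slab maxima, summed over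
    the q * M slabs. [B] bounds the block mass of a slab, which consists of
    K * (M * K)^(q-1) cells. *)
Lemma prob_max_osc_le (alpha : R) : 1 < alpha -> exists2 L : R, 1 <= L &
  forall (X : ('I_q -> \bar R) -> {RV P >-> R})
    (m : {measure set (borelRq R q) -> \bar R}) (c : R) (M K : nat)
    (b g : 'I_q -> nat -> \bar R) (delta B : R),
  constant_on_lower_boundary (fun t w => X t w) ->
  (m setT < +oo)%E -> 0 <= c ->
  (forall s t : 'I_q -> \bar R, (forall r, (s r <= t r)%E) ->
     ('E_P[fun w => (increment (fun x v => X x v) s t w ^+ 4)%R] <=
      poweR (m (hrect s t) + c%:E) alpha)%E) ->
  (forall r, g r 0%N = -oo%E) ->
  (forall r j, (j <= M)%N -> g r (j * K)%N = b r j) ->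
  (forall r, {homo g r : j k / (j <= k)%N >-> (j <= k)%E}) ->
  increasing_axes (M * K).+1 g ->
  0 < delta ->
  (forall r j, (j < M)%N ->
     marginal m r (b r j.+1) - marginal m r (b r j) + c * (K%:R * (M * K)%:R ^+ q.-1) <= B) ->
  (P [set w | (delta < max_osc (fun x v => X x v) M b (M * K).+1 g w)%R] <=
    ((2 * q%:R / delta) ^+ 4 * L * (q * M)%:R * B `^ alpha)%:E)%E.
Proof.
move=> a1; have [L L1 hL] := @maximal_inequality R q d T P alpha a1.
exists L => // X m c M K b g delta B Xc mfin c0 hmom g0 gb gle glt delta0 hB.
pose Y x v : R := X x v.
pose Z (p : 'I_q * 'I_M) := slab_max Y K g p.
pose h : R := 2 * q%:R / delta.
have qR : 0 < q%:R :> R by rewrite ltr0n.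
have h0 : 0 < h by rewrite divr_gt0// mulr_gt0.
have mD s t : measurable_fun setT (fun w : T => `|block_increment Y g s t w|).
  by apply: measurableT_comp => //; exact: measurable_increment.
have mZ p : measurable_fun setT (Z p).
  rewrite /Z /slab_max; elim: (enum 'I_q) (slab_hi _ _) => [|r rs IH] t /=; first exact: mD.
  by apply: measurable_bigmax => j; exact: IH.
have Zmom p : (moment4 P (Z p) <= (L * B `^ alpha)%:E)%E.
  apply: (le_trans (hL _ (block_mass m c g) mD _ _ _ _ _ _ _ (slab_le K p))) => //.
  - by move=> r s t j w st sjt; rewrite (block_increment_additive Y g w st sjt) ler_normD.
  - by move=> s t st; exact: block_mass_ge0.
  - exact: block_mass_additive.
  - by move=> s t st; apply: block_moment => //; lra.
  rewrite lee_fin; apply: ler_wpM2l; first by lra.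
  apply: le_powR; [by lra|exact: block_mass_ge0|].
  case: p => r j; apply: le_trans (hB r j (ltn_ord j)); rewrite /block_mass lerD//.
    have -> : b r j.+1 = gridpt g (slab_hi K (r, j)) r.
      by rewrite /gridpt /slab_hi upd_same gb.
    have -> : b r j = gridpt g (slab_lo K (r, j)) r.
      by rewrite /gridpt /slab_lo upd_same gb// ltnW.
    apply: fine_hrect_le => //; apply: gle; exact: slab_le.
  rewrite ler_wpM2l// (bigD1 r)//= /slab_hi /slab_lo !upd_same/=.
  rewrite -mulnBl subSnn mul1n ler_wpM2l//.
  rewrite (eq_bigr (fun=> (M * K)%:R)) => [|i ir]; last first.
    by rewrite /upd (negPf ir) subn0.
  by rewrite prodr_const cardC1 card_ord.
pose S w := \sum_(p : 'I_q * 'I_M) (h * Z p w) ^+ 4.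
have mX p : measurable_fun setT (fun w => (h * Z p w) ^+ 4).
  by apply: measurable_funX; exact: measurable_funM.
apply: (@le_trans _ _ (\int[P]_w (S w)%:E)%E).
  apply: prob_le_mean.
  - have := @measurable_max_osc R q d T P X M b (M * K).+1 g measurableT
      _ (measurable_itv `]delta, +oo[).
    by rewrite setTI; congr (measurable _); apply/seteqP; split=> w /=;
      rewrite in_itv/= andbT.
  - exact: measurable_sum.
  - by move=> w; apply: sumr_ge0 => p _; exact: pow4_ge0.
  - move=> w /=; apply: contraTT; rewrite -ltNge -leNgt => S1.
    have -> : delta = q%:R * (2 * h^-1) by rewrite /h; field; rewrite !gt_eqF.
    apply: max_osc_le => //; first by rewrite invr_ge0 ltW.
    move=> p; rewrite -[leRHS]mulr1 ler_pdivlMl//.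
    have Z0 : 0 <= h * Z p w.
      rewrite mulr_ge0 ?(ltW h0)// /Z /slab_max.
      by case: (enum _) => [|? ?] /=; [exact: normr_ge0|exact: bigmax_ge0].
    rewrite leNgt; apply/negP => Z1; move: S1; rewrite ltNge => /negP; apply.
    rewrite /S (bigD1 p)//= -[leLHS]addr0 lerD//.
      by rewrite exprn_ege1// ltW.
    by apply: sumr_ge0 => p' _; exact: pow4_ge0.
under eq_integral do rewrite /S -sumEFin.
rewrite ge0_integral_sum//; last 2 first.
- by move=> p; exact/measurable_EFinP.
- by move=> p w _; rewrite lee_fin pow4_ge0.
apply: (@le_trans _ _ (\sum_(p : 'I_q * 'I_M) (h ^+ 4 * (L * B `^ alpha))%:E)%E).
  apply: lee_sum => p _.
  under eq_integral do rewrite exprMn EFinM.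
  rewrite ge0_integralZl_EFin ?exprn_ge0 ?(ltW h0)//.
  - rewrite [leRHS]EFinM; apply: lee_wpmul2l; last exact: Zmom.
    by rewrite lee_fin exprn_ge0// ltW.
  - by move=> w _; rewrite lee_fin pow4_ge0.
  - exact: measurable_pow4.
rewrite sumEFin lee_fin sumr_const card_prod !card_ord -mulr_natl.
by rewrite /h le_eqVlt; apply/orP; left; apply/eqP; ring.
Qed.
End prob_max_osc_le.

(** * Choice of the grids *)

(** The sum of M terms of order M^-(1 + gamma) tends to 0. *)
Lemma coarse_grid_size (R : realType) (gamma A H eta : R) : 0 < gamma -> 0 <= A -> 0 <= H -> 0 < eta ->
  exists2 M : nat, (0 < M)%N & H * M%:R * (A / M%:R) `^ (1 + gamma) <= eta.
Proof.
move=> g0 A0 H0 e0; pose G := H * A `^ (1 + gamma).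
have G0 : 0 <= G by rewrite mulr_ge0// powR_ge0.
pose x := (G / eta) `^ gamma^-1.
exists (Num.bound x).+1 => //; set M := _.+1.
have M0 : 0 < M%:R :> R by rewrite ltr0n.
have xM : x <= M%:R.
  by rewrite ltW// (lt_trans (archi_boundP (powR_ge0 _ _)))// ltr_nat.
have GM : G <= eta * M%:R `^ gamma.
  rewrite mulrC -ler_pdivrMr//; apply: le_trans (_ : x `^ gamma <= _); last first.
    by apply: le_powR; [exact: ltW|exact: powR_ge0|].
  by rewrite /x -powRrM mulVf ?gt_eqF// powRr1// divr_ge0// ltW.
have Mg : 0 < M%:R `^ gamma by exact: powR_gt0.
have E : (A / M%:R) `^ (1 + gamma) * (M%:R * M%:R `^ gamma) = A `^ (1 + gamma).
  have -> : M%:R * M%:R `^ gamma = M%:R `^ (1 + gamma).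
    by rewrite -(@mulr_powRB1 _ _ (1 + gamma)) ?ltW ?addr_gt0// addrC addKr.
  by rewrite -powRM ?divr_ge0// ?ltW// divfK// gt_eqF.
rewrite -(ler_pM2r Mg); apply: le_trans GM.
by rewrite /G -E le_eqVlt; apply/orP; left; apply/eqP; ring.
Qed.

(** A fine grid with O(n) points in each coordinate has so few cells that the
    error terms n^-q of all cells of a slab add up to O(1 / M). *)
Lemma cell_count_le (R : realType) (q n M K : nat) : (0 < q)%N -> (0 < M)%N -> (0 < n)%N ->
  (M * K <= 2 * n)%N ->
  n%:R ^- q * (K%:R * (M * K)%:R ^+ q.-1) <= 2 ^+ q / M%:R :> R.
Proof.
move=> q0 M0 n0 MK.
have M0' : 0 < M%:R :> R by rewrite ltr0n.
have n0' : 0 < n%:R :> R by rewrite ltr0n.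
have -> : K%:R * (M * K)%:R ^+ q.-1 = (M * K)%:R ^+ q / M%:R :> R.
  by rewrite -[in RHS](prednK q0) exprS natrM; field; rewrite gt_eqF.
rewrite mulrA; apply: ler_wpM2r; first by rewrite invr_ge0 ltW.
rewrite mulrC ler_pdivrMr ?exprn_gt0//.
by rewrite -exprMn lerXn2r ?nnegrE ?mulr_ge0// -natrM ler_nat.
Qed.

Theorem lemma7p1 (R : realType) (q : nat) (hq : (0 < q)%N)
  (d : measure_display) (T : measurableType d) (P : probability T R)
  (X : nat -> ('I_q -> \bar R) -> {RV P >-> R})
  (hX : forall n, (0 < n)%N -> constant_on_lower_boundary (fun t w => X n t w))
  (mu_ : nat -> {measure set (borelRq R q) -> \bar R})
  (mu : {finite_measure set (borelRq R q) -> \bar R})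
  (hmu_ : forall n, (0 < n)%N -> continuous_marginals (mu_ n))
  (hmu : continuous_marginals mu)
  (hmu0 : mu setT <> 0%E)
  (hweak : converges_weakly mu_ mu)
  (gamma C : R) (hgamma : 0 < gamma) (hC : 0 <= C)
  (hmoment : forall n, (0 < n)%N ->
     forall s t : 'I_q -> \bar R, (forall r, (s r <= t r)%E) ->
     ('E_P[fun w => (increment (fun x v => X n x v) s t w ^+ 4)%R] <=
      poweR (mu_ n (hrect s t) + (C * n%:R ^- q)%R%:E) (1 + gamma)%R)%E)
  (delta eta : R) (hdelta : 0 < delta) (heta : 0 < eta) :
  exists (M : nat) (b : 'I_q -> nat -> \bar R)
         (Mn : nat -> nat) (tn : nat -> 'I_q -> nat -> \bar R),
    [/\ forall r, b r 0%N = -oo%E /\ b r M = +oo%E,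
        increasing_axes M.+1 b,
        forall n, (0 < n)%N -> increasing_axes (Mn n) (tn n),
        forall n, (0 < n)%N -> grid M.+1 b `<=` grid (Mn n) (tn n) &
        exists n0 : nat, forall n, (0 < n)%N -> (n0 <= n)%N ->
          (forall (r : 'I_q) (k : nat), (k.+1 < Mn n)%N ->
             (mu_ n (strip r (tn n r k) (tn n r k.+1)) <=
              2%:E * mu setT * (n%:R^-1)%R%:E)%E) /\
          (P [set w | (delta <
                max_osc (fun x v => X n x v) M b (Mn n) (tn n) w)%R] <=
           eta%:E)%E].
Proof.
have mufin : (mu setT < +oo)%E by rewrite -ge0_fin_numE// fin_num_measure.
pose A0 := fine (mu setT).
have muA : mu setT = A0%:E by rewrite /A0 fineK// ge0_fin_numE.
have A0_gt0 : 0 < A0.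
  by rewrite -lte_fin -muA lt0e measure_ge0 andbT; exact/eqP.
pose alpha := 1 + gamma.
have a1 : 1 < alpha by rewrite ltrDl.
have [L L1 hL] := @prob_max_osc_le R q d T P hq alpha a1.
pose A := 2 * A0 + C * 2 ^+ q.
have A_ge0 : 0 <= A by rewrite addr_ge0// mulr_ge0// ?exprn_ge0// ltW.
pose H := (2 * q%:R / delta) ^+ 4 * L * q%:R.
have H0 : 0 <= H.
  have L0 : 0 <= L by lra.
  do 2 (apply: mulr_ge0 => //); apply: exprn_ge0.
  by rewrite divr_ge0 ?mulr_ge0// ltW.
have [M M0 hM] := coarse_grid_size hgamma A_ge0 H0 heta.
have M0' : 0 < M%:R :> R by rewrite ltr0n.
have [b [b0 bM bmu]] := coarse_grid mufin hmu M0 A0_gt0.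
have bdiff r j : (j < M)%N -> marginal mu r (b r j.+1) - marginal mu r (b r j) = A0 / M%:R.
  by move=> jM; rewrite (bmu r j.+1 jM) (bmu r j (ltnW jM)) -natr1 -/A0; field; rewrite gt_eqF.
have AM0 : 0 < A0 / M%:R by rewrite divr_gt0.
have binc : increasing_axes M.+1 b.
  move=> r j k /andP[]; elim: k => // k IH; rewrite !ltnS leq_eqVlt => /predU1P[->|jk] kM.
    by apply: (marg_lt mufin (r := r)); rewrite -subr_gt0 bdiff.
  apply: lt_trans (IH jk (ltnW kM)) _.
  by apply: (marg_lt mufin (r := r)); rewrite -subr_gt0 bdiff.
have near_slab : \forall n \near \oo, (mu_ n setT < +oo)%E /\
    forall p : 'I_q * 'I_M,
      0 < marginal (mu_ n) p.1 (b p.1 p.2.+1) - marginal (mu_ n) p.1 (b p.1 p.2) < 2 * (A0 / M%:R).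
  apply: filterI; first exact: weak_near_finite mufin hweak.
  suff near1 (p : 'I_q * 'I_M) : \forall n \near \oo,
      0 < marginal (mu_ n) p.1 (b p.1 p.2.+1) - marginal (mu_ n) p.1 (b p.1 p.2) < 2 * (A0 / M%:R).
    exact: filter_forall near1.
  case: p => r j /=.
  have h : marginal (mu_ n) r (b r j.+1) - marginal (mu_ n) r (b r j) @[n --> \oo] --> A0 / M%:R.
    rewrite -(bdiff r j (ltn_ord j)).
    by apply: cvgB; exact: (weak_cvg_marg mufin hweak hmu).
  have h2 : A0 / M%:R < 2 * (A0 / M%:R) by lra.
  near=> n; apply/andP; split; near: n.
    exact: (cvgr_gt _ h).
  exact: (cvgr_lt _ h).
have [n0 _ hn0] := near_slab.
pose good n (p : nat * ('I_q -> nat -> \bar R)) :=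
  (forall (r : 'I_q) (k : nat), (k.+1 < p.1)%N ->
     (mu_ n (strip r (p.2 r k) (p.2 r k.+1)) <= 2%:E * mu setT * (n%:R^-1)%R%:E)%E) /\
  (P [set w | (delta < max_osc (fun x v => X n x v) M b p.1 p.2 w)%R] <= eta%:E)%E.
have /choice[F hF] : forall n, exists p : nat * ('I_q -> nat -> \bar R),
    [/\ increasing_axes p.1 p.2, grid M.+1 b `<=` grid p.1 p.2 &
       (0 < n)%N && (maxn n0 M <= n)%N -> good n p].
  (* For the remaining n, the coarse grid itself serves as the fine grid. *)
  move=> n; have [/andP[n_gt0]|_] := boolP ((0 < n)%N && _); last by exists (M.+1, b); split.
  rewrite geq_max => /andP[n0n Mn].
  have [nfin slab] := hn0 n n0n.
  (* About n points in each coordinate: n <= M * K makes the strips thin enough,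
     M * K <= 2 * n keeps the number of cells of order n ^ q. *)
  pose K := (n %/ M).+1%N.
  have nMK : (n <= M * K)%N by rewrite mulnC ltnW// ltn_ceil.
  have MKn : (M * K <= 2 * n)%N.
    by rewrite mulnS mulnC mul2n -addnn leq_add// leq_trunc_div.
  have [|g [gb gle ginc gstep]] := @fine_grid R q (mu_ n) nfin (hmu_ n n_gt0) M K b isT bM.
    by move=> r j jM; have /andP[+ _] := slab (r, Ordinal jM); rewrite subr_gt0.
  exists ((M * K).+1, g); split => //=.
    move=> _ [k kM ->]; exists (fun r => (k r * K)%N).
      by move=> r; rewrite ltnS leq_mul2r -ltnS kM orbT.
    by apply/funext => r; rewrite /gridpt gb// -ltnS.
  have n0' : 0 < n%:R :> R by rewrite ltr0n.
  have MK0' : 0 < M%:R * K%:R :> R by rewrite mulr_gt0// ltr0n.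
  move=> _; split.
    move=> r k; rewrite ltnS /= => kMK.
    rewrite (strip_margE nfin) ?gle// gstep// muA -!EFinM lee_fin.
    have kK : (k %/ K < M)%N by rewrite ltn_divLR.
    have /andP[_ /ltW s2] := slab (r, Ordinal kK); rewrite /= in s2.
    apply: (@le_trans _ _ (2 * (A0 / M%:R) / K%:R)).
      by rewrite ler_wpM2r ?invr_ge0.
    have -> : 2 * (A0 / M%:R) / K%:R = 2 * A0 / (M%:R * K%:R).
      by field; rewrite !gt_eqF// ltr0n.
    rewrite ler_wpM2l ?mulr_ge0 ?(ltW A0_gt0)// lef_pV2 ?posrE//.
    by rewrite -natrM ler_nat.
  have nq0 : 0 <= C * n%:R ^- q by rewrite mulr_ge0// invr_ge0 exprn_ge0.
  apply: le_trans (hL (X n) (mu_ n) (C * n%:R ^- q) M K b g delta (A / M%:R)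
    (hX n n_gt0) nfin nq0 (hmoment n n_gt0) _ gb gle ginc hdelta _) _.
  - by move=> r; have := gb r 0%N (leq0n _); rewrite mul0n b0.
  - move=> r j jM; have /andP[_ /ltW s2] := slab (r, Ordinal jM).
    rewrite /A mulrDl lerD//; first by rewrite -mulrA.
    rewrite -!mulrA ler_wpM2l// cell_count_le//.
  - rewrite lee_fin; apply: le_trans hM; rewrite /H natrM -/alpha.
    by rewrite le_eqVlt; apply/orP; left; apply/eqP; ring.
exists M, b, (fun n => (F n).1), (fun n => (F n).2); split => //.
- by move=> r; rewrite b0 bM.
- by move=> n _; have [] := hF n.
- by move=> n _; have [] := hF n.
exists (maxn n0 M) => n n_gt0 n_large; have [_ _] := hF n.
by rewrite n_gt0 n_large => /(_ isT).
Unshelve. all: by end_near. Qed.
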